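(* Let $R$ be a tolerance on a set $U$. Then $\mathit{RS}$ is a complete lattice if and only if it is a complete subdirect product of the complete lattices $\wp(U)^{\blacktriangledown}$ and $\wp(U)^{\blacktriangle}$.
   Context: A tolerance on $U$ is a reflexive and symmetric binary relation $R$ on $U$; $R(x)=\{y\in U\mid x\,R\,y\}$. For $X\subseteq U$, $X^{\blacktriangledown}=\{x\in U\mid R(x)\subseteq X\}$ and $X^{\blacktriangle}=\{x\in U\mid R(x)\cap X\neq\emptyset\}$. $\wp(U)^{\blacktriangledown}=\{X^{\blacktriangledown}\mid X\subseteq U\}$ and $\wp(U)^{\blacktriangle}=\{X^{\blacktriangle}\mid X\subseteq U\}$ are ordered by inclusion and are complete lattices: in $\wp(U)^{\blacktriangledown}$ meets are intersections and the join of $\{A_i\}$ is $((\bigcup_i A_i)^{\blacktriangle})^{\blacktriangledown}$; in $\wp(U)^{\blacktriangle}$ joins are unions and the meet of $\{B_i\}$ is $((\bigcap_i B_i)^{\blacktriangledown})^{\blacktriangle}$. $\mathit{RS}=\{(X^{\blacktriangledown},X^{\blacktriangle})\mid X\subseteq U\}\subseteq\wp(U)^{\blacktriangledown}\times\wp(U)^{\blacktriangle}$, ordered coordinatewise by inclusion. A complete subdirect product of a family of complete lattices $\{L_i\}_{i\in I}$ is a complete sublattice $\mathcal{L}$ of the direct product $\prod_{i\in I}L_i$ (i.e. closed under arbitrary joins and meets of the product) such that every canonical projection satisfies $\pi_i(\mathcal{L})=L_i$. *)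

(* Defs.v *)
From mathcomp Require Import all_boot all_order.
From mathcomp Require Import boolp classical_sets.

Set Implicit Arguments.
Unset Strict Implicit.
Unset Printing Implicit Defensive.

Import Order.TTheory.
Local Open Scope classical_set_scope.
Local Open Scope order_scope.

(* Posets are given as subsets [L] of an ambient poset [T], with the induced
   order.  Bounds are taken inside [L], so a supremum in [L] need not be a
   supremum in [T]. *)
Section CompleteLattices.
Context {d : Order.disp_t} {T : porderType d}.
Implicit Types (L M S : set T) (x : T).

Definition is_sup_in L S x : Prop :=
  [/\ L x, ubound S x & lbound (L `&` ubound S) x].

Definition is_inf_in L S x : Prop :=
  [/\ L x, lbound S x & ubound (L `&` lbound S) x].

(* [S] may be empty, so a complete lattice has a bottom and a top. *)
Definition complete_lattice L : Prop :=
  forall S, S `<=` L ->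
    (exists x, is_sup_in L S x) /\ (exists x, is_inf_in L S x).

(* The suprema and infima are those of [L], not those [M] may have as a poset
   of its own. *)
Definition complete_sublattice L M : Prop :=
  [/\ complete_lattice L,
      M `<=` L,
      forall S x, S `<=` M -> is_sup_in L S x -> M x
    & forall S x, S `<=` M -> is_inf_in L S x -> M x].

End CompleteLattices.

(* The case of a family of two lattices; [*p] carries the coordinatewise
   order. *)
Definition complete_subdirect_product {d1 d2 : Order.disp_t}
    {T1 : porderType d1} {T2 : porderType d2}
    (L1 : set T1) (L2 : set T2) (M : set (T1 *p T2)) : Prop :=
  [/\ complete_lattice L1,
      complete_lattice L2,
      complete_sublattice (L1 `*` L2 : set (T1 *p T2)) M,
      [set p.1 | p in M] = L1
    & [set p.2 | p in M] = L2].

Section RoughSets.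
Context {U : Type}.
Implicit Types (R : U -> U -> Prop) (X : set U).

Definition tolerance R : Prop :=
  (forall x, R x x) /\ (forall x y, R x y -> R y x).

Definition nbh R (x : U) : set U := [set y | R x y].

Definition lower R X : set U := [set x | nbh R x `<=` X].

Definition upper R X : set U := [set x | nbh R x `&` X !=set0].

(* The order of [set U] as a [porderType] is inclusion ([subsetEset]). *)
Definition lower_sets R : set (set U) := [set lower R X | X in setT].

Definition upper_sets R : set (set U) := [set upper R X | X in setT].

Definition RS R : set (set U *p set U) :=
  [set (lower R X, upper R X) | X in setT].

End RoughSets.

(* Main.v *)
Require Import Defs.
From mathcomp Require Import all_boot all_order.
From mathcomp Require Import boolp classical_sets.

(** Let [q] be the infimum in RS of a family and [x = (A, B)] its infimum in
    the product; clearly [q <= x].  If [u] is in [A], then the rough set of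
    [R(u)] is a lower bound of the family with [u] in its first component.  If
    [u] is in [B = upper R Y], choose [z] in both [R(u)] and [Y]: the rough set
    of [{z}] is a lower bound of the family with [u] in its second component.
    Hence [x <= q].  Suprema are treated dually, with the complements of [R(u)]
    and [{z}].  So the mere existence of bounds in RS forces them to be those of
    the product. *)

Set Implicit Arguments.
Unset Strict Implicit.
Unset Printing Implicit Defensive.

Import Order.TTheory.
Local Open Scope classical_set_scope.
Local Open Scope order_scope.

Section CompleteLatticeTheory.
Context {d : Order.disp_t} {T : porderType d}.
Implicit Types (L M S : set T) (x y : T).

Lemma complete_lattice_of_inf L :
  (forall S, S `<=` L -> exists x, is_inf_in L S x) -> complete_lattice L.
Proof.
move=> infL S SL; split; last exact: infL.
have [x [Lx lbx ubx]] := infL (L `&` ubound S) (@subIsetl _ _ _).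
exists x; split=> // y Sy.
by apply: ubx; split=> [|z [_ ubz]]; [exact: SL | exact: ubz].
Qed.

Lemma complete_lattice_of_sup L :
  (forall S, S `<=` L -> exists x, is_sup_in L S x) -> complete_lattice L.
Proof.
move=> supL S SL; split; first exact: supL.
have [x [Lx ubx lbx]] := supL (L `&` lbound S) (@subIsetl _ _ _).
exists x; split=> // y Sy.
by apply: lbx; split=> [|z [_ lbz]]; [exact: SL | exact: lbz].
Qed.

(** This yields the converse direction: a bound computed in [L] lies in [M] by closure, and stays
    optimal among the fewer competitors there. *)
Lemma complete_sublattice_complete L M :
  complete_sublattice L M -> complete_lattice M.
Proof.
move=> [cL ML supM infM] S SM.
have [[x xsup] [y yinf]] := cL S (subset_trans SM ML).
split.
  exists x; have [_ ubx lbx] := xsup; split=> //; first exact: supM xsup.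
  by move=> z [Mz ubz]; apply: lbx; split=> //; apply: ML.
exists y; have [_ lby uby] := yinf; split=> //; first exact: infM yinf.
by move=> z [Mz lbz]; apply: uby; split=> //; apply: ML.
Qed.

End CompleteLatticeTheory.

Section ProductLattice.
Context {d1 d2 : Order.disp_t} {T1 : porderType d1} {T2 : porderType d2}.

Lemma complete_lattice_prod (L1 : set T1) (L2 : set T2) :
  complete_lattice L1 -> complete_lattice L2 ->
  complete_lattice (L1 `*` L2 : set (T1 *p T2)).
Proof.
move=> c1 c2; apply: complete_lattice_of_inf => S SL.
have S1 : [set p.1 | p in S] `<=` L1 by move=> _ [p /SL [? _] <-].
have S2 : [set p.2 | p in S] `<=` L2 by move=> _ [p /SL [_ ?] <-].
have [_ [x1 [Lx1 lb1 ub1]]] := c1 _ S1.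
have [_ [x2 [Lx2 lb2 ub2]]] := c2 _ S2.
exists (x1, x2); split=> // p.
  move=> Sp; rewrite Order.ProdOrder.leEprod /=; apply/andP.
  by split; [apply: lb1 | apply: lb2]; exists p.
move=> [[Lp1 Lp2] lbp]; rewrite Order.ProdOrder.leEprod /=; apply/andP.
split; [apply: ub1 | apply: ub2]; split=> // _ [s /lbp + <-];
  by rewrite Order.ProdOrder.leEprod => /andP[].
Qed.

End ProductLattice.

Section ToleranceRoughSets.
Context {U : Type}.
Implicit Types (R : U -> U -> Prop) (X Y A B : set U).
Implicit Types S : set (set U *p set U).

Lemma le_rough_pairE (p q : set U *p set U) :
  (p <= q) <-> p.1 `<=` q.1 /\ p.2 `<=` q.2.
Proof.
rewrite Order.ProdOrder.leEprod -!subsetEset.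
by split=> [/andP|?]; last exact/andP.
Qed.

Lemma lowerS R X Y : X `<=` Y -> lower R X `<=` lower R Y.
Proof. by move=> XY x RxX y /RxX /XY. Qed.

Lemma upperS R X Y : X `<=` Y -> upper R X `<=` upper R Y.
Proof. by move=> XY x [y [Rxy /XY]]; exists y. Qed.

Lemma complete_lattice_lower_sets R : complete_lattice (lower_sets R).
Proof.
apply: complete_lattice_of_inf => S SL; exists (\bigcap_(A in S) A); split.
(* [lower R] commutes with intersections. Taking every [X] whose lower approximation is in [S]
   avoids choosing one preimage per member. *)
- exists (\bigcap_(X in [set X | S (lower R X)]) X) => //.
  apply/seteqP; split=> x.
    by move=> Hx A SA; have [X _ AX] := SL _ SA; move: SA;
      rewrite -AX => SX y Rxy; exact: Hx.
  by move=> Hx y Rxy X SX; exact: Hx SX _ Rxy.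
- by move=> A SA; rewrite subsetEset => x; apply.
- move=> B [_ lbB]; rewrite subsetEset => x Bx A SA.
  by have := lbB _ SA; rewrite subsetEset; apply.
Qed.

Lemma complete_lattice_upper_sets R : complete_lattice (upper_sets R).
Proof.
apply: complete_lattice_of_sup => S SL; exists (\bigcup_(A in S) A); split.
(* Likewise [upper R] commutes with unions. *)
- exists (\bigcup_(X in [set X | S (upper R X)]) X) => //.
  apply/seteqP; split=> x.
    by move=> [y [Rxy [X SX Xy]]]; exists (upper R X) => //; exists y.
  move=> [A SA]; have [X _ AX] := SL _ SA; move: SA; rewrite -AX => SX.
  by move=> [y [Rxy Xy]]; exists y; split=> //; exists X.
- by move=> A SA; rewrite subsetEset => x Ax; exists A.
- move=> B [_ ubB]; rewrite subsetEset => x [A SA Ax].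
  by have := ubB _ SA; rewrite subsetEset; apply.
Qed.

Lemma RS_sub_prod R :
  RS R `<=` (lower_sets R `*` upper_sets R : set (set U *p set U)).
Proof. by move=> _ [X _ <-]; split; exists X. Qed.

Lemma fst_RS R : [set p.1 | p in RS R] = lower_sets R.
Proof.
apply/seteqP; split=> [_ [_ [X _ <-] <-]|_ [X _ <-]]; first by exists X.
by exists (lower R X, upper R X) => //; exists X.
Qed.

Lemma snd_RS R : [set p.2 | p in RS R] = upper_sets R.
Proof.
apply/seteqP; split=> [_ [_ [X _ <-] <-]|_ [X _ <-]]; first by exists X.
by exists (lower R X, upper R X) => //; exists X.
Qed.

(* The first component matters only when [R(z) = {z}]; otherwise
   [lower R {z}] is empty. *)
Lemma rough_set1_le R X z : (forall x, R x x) ->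
  upper R [set z] `<=` upper R X -> lower R [set z] `<=` lower R X.
Proof.
move=> rR zX u Ruz.
have uz : u = z by apply: Ruz; exact: rR.
have [|w [Rzw Xw]] := zX z; first by exists z; split=> //; exact: rR.
have wz : w = z by apply: Ruz; rewrite uz.
by move=> y /Ruz ->; rewrite -wz.
Qed.

(** A point [u] of [upper R X] outside [upper R (~]
    [set z])[has all its neighbours equal to]z[, so]u =
    z[by reflexivity and]z[is in]X[. Then]z[lies in]lower R X[but not in]lower R (~[[set z])]. *)
Lemma rough_setC1_ge R X z : (forall x, R x x) ->
  lower R X `<=` lower R (~` [set z]) -> upper R X `<=` upper R (~` [set z]).
Proof.
move=> rR Xz u [w [Ruw Xw]]; apply: contrapT => nu.
have Ruz y : R u y -> y = z.
  by move=> Ruy; apply: contrapT => nyz; apply: nu; exists y.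
have uz := Ruz u (rR u); have wz := Ruz w Ruw; subst u w.
have zX : lower R X z by move=> y /Ruz ->.
by have := Xz _ zX z (rR z); apply.
Qed.

Lemma RS_inf_closed R S x : (forall x, R x x) -> complete_lattice (RS R) ->
  S `<=` RS R ->
  is_inf_in (lower_sets R `*` upper_sets R : set (set U *p set U)) S x ->
  RS R x.
Proof.
(* The coordinates of [x] come from separate sets [A] and [B], so [x] need not be a rough set a
   priori. *)
move=> rR cRS SRS [[[A _ xA] [B _ xB]] lbx ubx].
have [_ [q [RSq lbq ubq]]] := cRS _ SRS.
suff <- : q = x by [].
apply: le_anti; apply/andP; split.
  by apply: ubx; split=> //; exact: RS_sub_prod RSq.
have q_ge Y : (forall X, S (lower R X, upper R X) ->
    lower R Y `<=` lower R X /\ upper R Y `<=` upper R X) ->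
    lower R Y `<=` q.1 /\ upper R Y `<=` q.2.
  move=> HY; apply/(le_rough_pairE (lower R Y, upper R Y)).
  apply: ubq; split; first by exists Y.
  move=> p Sp; have [X _ pX] := SRS _ Sp; move: Sp; rewrite -pX => SX.
  by apply/le_rough_pairE; exact: HY.
have x_le X : S (lower R X, upper R X) ->
    lower R A `<=` lower R X /\ upper R B `<=` upper R X.
  by move=> /lbx /le_rough_pairE; rewrite -xA -xB.
apply/le_rough_pairE; rewrite -xA -xB; split=> u.
  move=> Au; have [+ _] : lower R (nbh R u) `<=` q.1 /\
      upper R (nbh R u) `<=` q.2.
    (* Here [AX] sends [u] into [lower R X], that is, [nbh R u] is contained in [X]. *)
    apply: q_ge => X /x_le [AX _].
    by split; [apply: lowerS | apply: upperS]; exact: AX.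
  by apply.
move=> [z [Ruz Bz]]; have [_ +] : lower R [set z] `<=` q.1 /\
    upper R [set z] `<=` q.2.
  apply: q_ge => X /x_le [_ BX].
  (* As [z] is in [B], the second components compare through [upper R B]; the first then follow. *)
  have zX : upper R [set z] `<=` upper R X.
    by apply: subset_trans BX; apply: upperS => _ ->.
  by split=> //; exact: rough_set1_le.
by apply; exists z.
Qed.

Lemma RS_sup_closed R S x : (forall x, R x x) -> complete_lattice (RS R) ->
  S `<=` RS R ->
  is_sup_in (lower_sets R `*` upper_sets R : set (set U *p set U)) S x ->
  RS R x.
Proof.
move=> rR cRS SRS [[[A _ xA] [B _ xB]] ubx lbx].
have [[q [RSq ubq lbq]] _] := cRS _ SRS.
suff <- : q = x by [].
apply: le_anti; apply/andP; split; last first.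
  by apply: lbx; split=> //; exact: RS_sub_prod RSq.
have q_le Y : (forall X, S (lower R X, upper R X) ->
    lower R X `<=` lower R Y /\ upper R X `<=` upper R Y) ->
    q.1 `<=` lower R Y /\ q.2 `<=` upper R Y.
  move=> HY; apply/(le_rough_pairE q (lower R Y, upper R Y)).
  apply: lbq; split; first by exists Y.
  move=> p Sp; have [X _ pX] := SRS _ Sp; move: Sp; rewrite -pX => SX.
  by apply/le_rough_pairE; exact: HY.
have x_ge X : S (lower R X, upper R X) ->
    lower R X `<=` lower R A /\ upper R X `<=` upper R B.
  by move=> /ubx /le_rough_pairE; rewrite -xA -xB.
apply/le_rough_pairE; rewrite -xA -xB; split=> u; last first.
  move=> qu; apply: contrapT => nBu.
  have [_ /(_ _ qu) [y [Ruy nRuy]]] : q.1 `<=` lower R (~` nbh R u) /\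
      q.2 `<=` upper R (~` nbh R u).
    apply: q_le => X /x_ge [_ XB].
    (* A neighbour of [u] in [X] would put [u] in [upper R X], hence in [upper R B]. *)
    have XC : X `<=` ~` nbh R u.
      by move=> y Xy Ruy; apply: nBu; apply: XB; exists y.
    by split; [exact: lowerS | exact: upperS].
  exact: nRuy Ruy.
move=> qu z Ruz; apply: contrapT => nAz.
have [/(_ _ qu) uz _] : q.1 `<=` lower R (~` [set z]) /\
    q.2 `<=` upper R (~` [set z]).
  apply: q_le => X /x_ge [XA _].
  (* Since [z] is not in [A], the set [A] lies in the complement of [[set z]]. *)
  have Xz : lower R X `<=` lower R (~` [set z]).
    apply: subset_trans XA _; apply: lowerS => y Ay yz.
    by apply: nAz; rewrite -yz.
  by split=> //; exact: rough_setC1_ge.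
exact: uz Ruz erefl.
Qed.

End ToleranceRoughSets.

Theorem corollary4p5 (U : Type) (R : U -> U -> Prop) (hR : tolerance R) :
  complete_lattice (RS R) <->
  complete_subdirect_product (lower_sets R) (upper_sets R) (RS R).
Proof.
have [rR _] := hR.
split=> [cRS|[_ _ + _ _]]; last exact: complete_sublattice_complete.
have cl := @complete_lattice_lower_sets U R.
have cu := @complete_lattice_upper_sets U R.
split=> //; [split|exact: fst_RS|exact: snd_RS].
- exact: complete_lattice_prod.
- exact: RS_sub_prod.
- by move=> S x; exact: RS_sup_closed.
- by move=> S x; exact: RS_inf_closed.
Qed.
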